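(* Let $2\le n<\infty$, $m=(n-1)k+1$ with $k\ge 2$, and $z=(z_1,\ldots,z_m)\in(\mathbb{C}^m)_1$. If $|z_m|=1$, then any geometric progression state on $\mathcal{O}_n$ by $z$ is a convex combination of the $k$ Cuntz states on $\mathcal{O}_n$ by the vectors $(0,\ldots,0,e^{2\pi j\sqrt{-1}/k}q)\in\mathbb{C}^n$, $j=1,\ldots,k$, where $q$ is a $k$-th root of $z_m$.
   Context: For $2\le n<\infty$, $\mathcal{O}_n$ denotes the Cuntz algebra: the universal unital C$^*$-algebra generated by $s_1,\ldots,s_n$ with $s_i^*s_j=\delta_{ij}I$ and $\sum_{i=1}^n s_is_i^*=I$. $(\mathbb{C}^m)_1$ is the set of unit vectors of $\mathbb{C}^m$. Convention: $s_n^0=I$. Geometric progression state of order $k$: for $m=(n-1)k+1$, a state $\omega$ on $\mathcal{O}_n$ is a geometric progression state by $z\in(\mathbb{C}^m)_1$ if $\omega(s_n^rs_i)=\overline{z_{(n-1)r+i}}$ for all $r=0,\ldots,k-1$ and $i=1,\ldots,n-1$, and $\omega(s_n^k)=\overline{z_m}$. Cuntz state: for a unit vector $y\in\mathbb{C}^n$, the Cuntz state on $\mathcal{O}_n$ by $y$ is the unique (and pure) state $\omega_y$ with $\omega_y(s_j)=\overline{y_j}$ for $j=1,\ldots,n$. *)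

(* Defs.v *)
From HB Require Import structures.
From mathcomp Require Import all_boot all_order all_algebra.
From mathcomp Require Import all_classical all_reals all_analysis.
From mathcomp Require Import complex.

Set Implicit Arguments.
Unset Strict Implicit.
Unset Printing Implicit Defensive.

Import Order.TTheory GRing.Theory Num.Theory.

Local Open Scope classical_set_scope.
Local Open Scope ring_scope.
Local Open Scope complex_scope.

(* The norm is a field of the mixin, with completeness spelled out: HB does
   not accept a join of the library's normed modules with its algebras
   (numDomainType already inherits from rings and from normed Z-modules without
   a common join).  [GRing.Algebra] is unital with 1 != 0, so the zero algebra
   is excluded. *)
HB.mixin Record isCstarAlgebra (R : realType) A of GRing.Algebra R[i] A := {
  cnorm : A -> R ;
  star : A -> A ;
  cnorm_eq0 : forall a, cnorm a = 0 -> a = 0 ;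
  cnormD : forall a b, cnorm (a + b) <= cnorm a + cnorm b ;
  cnormZ : forall (c : R[i]) a, cnorm (c *: a) = Normc.normc c * cnorm a ;
  cnormM : forall a b : A, cnorm (a * b) <= cnorm a * cnorm b ;
  cnorm_complete : forall u : nat -> A,
    (forall e : R, 0 < e -> exists N : nat, forall i j : nat,
        (N <= i)%N -> (N <= j)%N -> cnorm (u i - u j) < e) ->
    exists l : A, forall e : R, 0 < e -> exists N : nat, forall i : nat,
        (N <= i)%N -> cnorm (u i - l) < e ;
  starK : involutive star ;
  starD : {morph star : a b / a + b} ;
  starZ : forall (c : R[i]) (a : A), star (c *: a) = c^*%R *: star a ;
  starM : forall a b : A, star (a * b) = star b * star a ;
  cnorm_starM : forall a : A, cnorm (star a * a) = cnorm a ^+ 2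
}.

#[short(type="cstarAlgType")]
HB.structure Definition CstarAlgebra (R : realType) :=
  {A of GRing.Algebra R[i] A & isCstarAlgebra R A}.

Definition cuntz_family (R : realType) (n : nat) (A : cstarAlgType R)
    (s : 'I_n -> A) : Prop :=
  (forall i j : 'I_n, star (s i) * s j = (i == j)%:R) /\
  \sum_(i < n) s i * star (s i) = 1.

Definition norm_closed (R : realType) (A : cstarAlgType R) (S : set A) : Prop :=
  forall a : A,
    (forall e : R, 0 < e -> exists2 b : A, S b & cnorm (b - a) < e) -> S a.

Definition cstar_subalgebra (R : realType) (A : cstarAlgType R)
    (S : set A) : Prop :=
  [/\ S 1,
      forall (c : R[i]) (a b : A), S a -> S b -> S (c *: a + b),
      forall a b : A, S a -> S b -> S (a * b),
      forall a : A, S a -> S (star a) &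
      norm_closed S].

Definition cstar_generated (R : realType) (n : nat) (A : cstarAlgType R)
    (s : 'I_n -> A) : Prop :=
  forall S : set A, cstar_subalgebra S -> (forall i : 'I_n, S (s i)) ->
    S = [set: A].

(* (A, s) is the Cuntz algebra O_n together with its canonical generators.
   The morphism phi is unique because s generates A and *-homomorphisms of
   C*-algebras are contractive. *)
Definition is_cuntz_algebra (R : realType) (n : nat) (A : cstarAlgType R)
    (s : 'I_n -> A) : Prop :=
  [/\ cuntz_family s, cstar_generated s &
      forall (B : cstarAlgType R) (t : 'I_n -> B), cuntz_family t ->
        exists phi : {lrmorphism A -> B},
          (forall a : A, phi (star a) = star (phi a)) /\
          (forall i : 'I_n, phi (s i) = t i)].

(* [0 <= x] in R[i] means that x is real and nonnegative. *)
Definition is_state (R : realType) (A : cstarAlgType R)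
    (omega : {scalar A}) : Prop :=
  (forall a : A, 0 <= omega (star a * a)) /\ omega 1 = 1.

Definition unit_vector (R : realType) (m : nat) (z : 'rV[R[i]]_m) : Prop :=
  \sum_(i < m) `|z 0 i| ^+ 2 = 1.

Definition last_ord (n : nat) (hn : (2 <= n)%N) : 'I_n :=
  Ordinal (etrans (ltn_predL n) (ltnW hn)).

(* Indices are shifted by one: i < n.-1 stands for i + 1 = 1, ..., n - 1, and
   z_((n-1) r + i + 1) is the coordinate of index n.-1 * r + i, which is always
   in range, so that [inord] never takes its default value. *)
Definition geometric_progression_state (R : realType) (n k : nat)
    (hn : (2 <= n)%N) (A : cstarAlgType R) (s : 'I_n -> A)
    (z : 'rV[R[i]]_(n.-1 * k).+1) (omega : {scalar A}) : Prop :=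
  [/\ unit_vector z, is_state omega,
      forall (r : 'I_k) (i : 'I_n.-1),
        omega (s (last_ord hn) ^+ r * s (widen_ord (leq_pred n) i))
        = (z 0 (inord (n.-1 * r + i)))^*%R &
      omega (s (last_ord hn) ^+ k) = (z 0 ord_max)^*%R].

Definition cuntz_state (R : realType) (n : nat) (A : cstarAlgType R)
    (s : 'I_n -> A) (y : 'rV[R[i]]_n) (omega : {scalar A}) : Prop :=
  [/\ unit_vector y, is_state omega &
      forall j : 'I_n, omega (s j) = (y 0 j)^*%R].

Definition expi (R : realType) (t : R) : R[i] := cos t +i* sin t.

Definition last_coord_vec (R : realType) (n : nat) (hn : (2 <= n)%N)
    (c : R[i]) : 'rV[R[i]]_n :=
  \row_(i < n) (if i == last_ord hn then c else 0).

(* Main.v *)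
Require Import Defs.
From HB Require Import structures.
From mathcomp Require Import all_boot all_order all_algebra.
From mathcomp Require Import all_classical all_reals all_analysis.
From mathcomp Require Import complex.
From mathcomp Require Import ring lra.

Set Implicit Arguments.
Unset Strict Implicit.
Unset Printing Implicit Defensive.

Import Order.TTheory GRing.Theory Num.Theory.

Local Open Scope ring_scope.
Local Open Scope complex_scope.

(* Put c = conj z_m, so that |c| = 1, and let Omega be the cyclic vector of the
   GNS representation of omega.  As s_n^k is an isometry and
   <Omega, s_n^k Omega> = c, equality in Cauchy-Schwarz gives s_n^k Omega = c Omega.
   Averaging over the k-th roots of unity splits Omega = sum_j P_j Omega, where
   P_j Omega is an eigenvector of s_n with eigenvalue conj (u_j), u_j^k = z_m.
   Each s_l^* maps P_j Omega to a multiple of itself, so the span of the products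
   s_I s_J^*, which is dense, has no matrix coefficients between different P_j Omega;
   hence omega is the sum of the functionals of the vectors P_j Omega, and these are
   multiples of Cuntz states.  If P_j Omega = 0, the j-th Cuntz state is obtained
   from another one by a gauge automorphism. *)

Lemma conjC_real_complex (R : rcfType) (r : R) : (r%:C)^*%R = r%:C.
Proof. exact: conjc_real. Qed.

(** * Norm estimates and square roots in a C*-algebra *)

Section Norm.
Variables (R : realType) (A : cstarAlgType R).
Implicit Types a b h y : A.

Lemma star0 : star (0 : A) = 0.
Proof. by apply: (addrI (star (0 : A))); rewrite -starD !addr0. Qed.

Lemma starN a : star (- a) = - star a.
Proof. by apply: (addrI (star a)); rewrite -starD !subrr star0. Qed.

Lemma star1 : star (1 : A) = 1.
Proof. by have := starM (star (1 : A)) 1; rewrite mulr1 starK mulr1. Qed.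

Lemma star_sum (I : Type) (r : seq I) (F : I -> A) :
  star (\sum_(i <- r) F i) = \sum_(i <- r) star (F i).
Proof. by apply: (big_morph _ (@starD R A)); rewrite star0. Qed.

Lemma cnorm0 : cnorm (0 : A) = 0.
Proof. by rewrite -(scale0r (0 : A)) cnormZ Normc.normc0 mul0r. Qed.

Lemma cnormZreal (r : R) a : cnorm (r%:C *: a) = `|r| * cnorm a.
Proof. by rewrite cnormZ /Normc.normc /= expr0n addr0 sqrtr_sqr. Qed.

Lemma cnormN a : cnorm (- a) = cnorm a.
Proof. by rewrite -scaleN1r -(rmorphN1 (real_complex R)) cnormZreal normrN1 mul1r. Qed.

Lemma cnorm_distC a b : cnorm (a - b) = cnorm (b - a).
Proof. by rewrite -cnormN opprB. Qed.

Lemma cnorm_ge0 a : 0 <= cnorm a.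
Proof. by have := cnormD a (- a); rewrite subrr cnorm0 cnormN; lra. Qed.

(** The C*-identity and submultiplicativity give ||b||^2 = ||b* b|| <= ||b*|| ||b||; cancel ||b||,
    then take both b = a and b = a*. *)
Lemma cnorm_star a : cnorm (star a) = cnorm a.
Proof.
have le_star b : cnorm b <= cnorm (star b).
  have := cnormM (star b) b; rewrite cnorm_starM expr2.
  have [->|b0] := eqVneq (cnorm b) 0; first by rewrite cnorm_ge0.
  by rewrite ler_pM2r // lt_neqAle eq_sym b0 cnorm_ge0.
by apply/eqP; rewrite eq_le le_star -{2}(starK a) le_star.
Qed.

Lemma cnorm_lt_eq0 a : (forall e : R, 0 < e -> cnorm a < e) -> a = 0.
Proof.
move=> small; apply/(@cnorm_eq0 R)/eqP; rewrite -[_ == _]negbK; apply/negP => a0.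
by have := small (cnorm a); rewrite ltxx lt_neqAle eq_sym a0 cnorm_ge0 => /(_ isT).
Qed.

(* [1 - h = (1 - y) ^ 2] amounts to the fixed-point equation
   [y = (h + y ^ 2) / 2], a contraction on the ball of radius 1/2. *)
Lemma sqrt_one_sub h : star h = h -> cnorm h <= 2^-1 ->
  exists2 y, star y = y & 1 - h = y * y.
Proof.
move=> hsa hle.
pose F y : A := (2^-1)%:C *: (h + y * y); pose u m := iter m F 0.
have normF a : cnorm ((2^-1 : R)%:C *: a) = 2^-1 * cnorm a.
  by rewrite cnormZreal ger0_norm // invr_ge0.
have u_ball m : cnorm (u m) <= 2^-1.
  elim: m => [|m IH]; first by rewrite cnorm0 invr_ge0.
  rewrite [u _]/(F (u m)) normF.
  have := cnormD h (u m * u m); have := cnormM (u m) (u m).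
  by have := cnorm_ge0 (u m); nra.
have F_dist a b : cnorm (F a - F b) <= 2^-1 * ((cnorm a + cnorm b) * cnorm (a - b)).
  rewrite -scalerBr normF ler_pM2l ?invr_gt0 //.
  have -> : h + a * a - (h + b * b) = a * (a - b) + (a - b) * b.
    by rewrite mulrBr mulrBl addrA subrK opprD addrACA subrr add0r.
  apply: le_trans (cnormD _ _) _.
  by have := cnormM a (a - b); have := cnormM (a - b) b; nra.
(* By [u_ball] the two norms in [F_dist] add up to at most 1, so each application of [F] halves
   distances. *)
have u_cauchy m p : cnorm (u (m + p)%N - u m) <= 2^-1 ^+ m.
  elim: m => [|m IH].
    by rewrite subr0 expr0 (le_trans (u_ball _)) // invf_le1 // ler1n.
  rewrite addSn exprS (le_trans (F_dist _ _)) // ler_pM2l ?invr_gt0 //.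
  have := u_ball (m + p)%N; have := u_ball m.
  have := cnorm_ge0 (u (m + p)%N - u m); nra.
have pow_small (e : R) : 0 < e -> exists N, forall m, (N <= m)%N -> 2^-1 ^+ m < e.
  move=> e0; exists (Num.bound e^-1) => m le_m.
  rewrite exprVn invf_plt ?posrE ?exprn_gt0 //.
  apply: lt_le_trans (archi_boundP _) _; first by rewrite invr_ge0 ltW.
  by rewrite -natrX ler_nat (leq_trans le_m) // ltnW // ltn_expl.
have [e e0|l ul] := @cnorm_complete R A u.
  have [N HN] := pow_small (e / 2) (divr_gt0 e0 (ltr0n _ 2)).
  exists N => i j Ni Nj.
  have -> : u i - u j = (u i - u N) + - (u j - u N) by rewrite opprB addrA subrK.
  apply: le_lt_trans (cnormD _ _) _; rewrite cnormN.
  have := u_cauchy N (i - N)%N; have := u_cauchy N (j - N)%N.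
  rewrite !subnKC //; have := HN N (leqnn N); lra.
have u_sa m : star (u m) = u m.
  elim: m => [|m IH]; first exact: star0.
  by rewrite [u _]/(F (u m)) starZ starD starM hsa IH /F conjC_real_complex.
have lsa : star l = l.
  apply/eqP; rewrite -subr_eq0; apply/eqP/cnorm_lt_eq0 => e e0.
  have [N /(_ N (leqnn N)) HN] := ul (e / 2) (divr_gt0 e0 (ltr0n _ 2)).
  have -> : star l - l = - star (u N - l) + (u N - l).
    by rewrite starD starN u_sa opprB addrA subrK.
  by apply: le_lt_trans (cnormD _ _) _; rewrite cnormN cnorm_star; lra.
have fixl : l = F l.
  apply/eqP; rewrite -subr_eq0; apply/eqP/cnorm_lt_eq0 => e e0.
  have m0 : 0 < Num.min (e / 2) 2^-1 :> R by rewrite lt_min divr_gt0 //= invr_gt0 ltr0n.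
  have [N HN] := ul _ m0.
  have := HN N (leqnn N); rewrite lt_min => /andP[HNe HNl].
  have := HN N.+1 (leqnSn N); rewrite lt_min => /andP[HSe _].
  have -> : l - F l = (F (u N) - F l) - (u N.+1 - l).
    by rewrite -[u N.+1]/(F (u N)) opprB [RHS]addrC addrA subrK.
  apply: le_lt_trans (cnormD _ _) _; rewrite cnormN.
  have := F_dist (u N) l; have := u_ball N.
  have : cnorm l <= 1.
    have -> : l = u N - (u N - l) by rewrite subKr.
    by apply: le_trans (cnormD _ _) _; rewrite cnormN; have := u_ball N; lra.
  have := cnorm_ge0 (u N - l); nra.
(* The root is [1 - l]: the fixed-point equation reads 2l = h + l^2, whence (1 - l)^2 = 1 - h. *)
exists (1 - l); first by rewrite starD starN star1 lsa.
have : (2 : R)%:C *: l = h + l * l.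
  by rewrite {1}fixl scalerA -rmorphM /= divff ?pnatr_eq0 // scale1r.
rewrite rmorphD rmorph1 scalerDl scale1r => /esym/(canRL (addrK _)) ->.
by rewrite mulrBr !mulrBl !mulr1 mul1r !opprB opprD -[RHS]addrA; congr (_ + _); rewrite addrCA.
Qed.

End Norm.

(** * States: symmetry, null vectors and continuity *)

Section State.
Variables (R : realType) (A : cstarAlgType R) (omega : {scalar A}).
Hypothesis omega_state : is_state omega.
Implicit Types a b x y : A.

Let omega_ge0 a : 0 <= omega (star a * a). Proof. by case: omega_state. Qed.
Let omega1 : omega 1 = 1. Proof. by case: omega_state. Qed.

Lemma state_square_sub a b (c : R[i]) :
  omega (star (a - c *: b) * (a - c *: b)) =
  omega (star a * a) - c * omega (star a * b) - c^*%R * omega (star b * a)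
  + c * c^*%R * omega (star b * b).
Proof.
rewrite starD starN starZ mulrBl !mulrBr -!scalerAl -!scalerAr !linearB !linearZ /=.
ring.
Qed.

Lemma state_star a : omega (star a) = (omega a)^*%R.
Proof.
have real_sum (c : R[i]) : (c * omega (star a) + c^*%R * omega a)^*%R =
    c * omega (star a) + c^*%R * omega a.
  have <- : omega (star a * a) + c * c^*%R -
      omega (star (a - c *: 1) * (a - c *: 1)) = c * omega (star a) + c^*%R * omega a.
    by rewrite state_square_sub star1 !mulr1 mul1r omega1; ring.
  apply: conj_Creal.
  by rewrite realB ?realD // ger0_real ?omega_ge0 ?mul_conjC_ge0.
have := real_sum 1; have := real_sum 'i%R.
rewrite !rmorphD !rmorphM /= !conjCK !rmorph1 !mul1r conjCi.
move: (omega (star a)) (omega a) => x y ei e1.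
have {}ei : y^*%R - x^*%R = x - y.
  by apply: (mulfI (neq0Ci R[i])); rewrite !mulrBr; move: ei; rewrite !mulNr addrC.
have e2 : x + x = y^*%R + y^*%R.
  have -> : x + x = (x + y) + (x - y) by ring.
  by rewrite -e1 -ei; ring.
have two0 : (2 : R[i]) != 0 by rewrite pnatr_eq0.
by apply: (mulfI two0); rewrite !mulr_natl !mulr2n.
Qed.

Lemma state_null a b : omega (star b * b) = 0 -> omega (a * b) = 0.
Proof.
move=> b0; rewrite -(starK a); move: (star a) => {}a.
set g := omega _; have gC : omega (star b * a) = g^*%R.
  by rewrite -state_star starM starK.
apply/eqP; rewrite -[_ == _]negbK; apply/negP => g0.
have n0 : 0 < g * g^*%R by rewrite -normCK exprn_gt0 ?normr_gt0.
set p := omega (star a * a).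
have p0 : 0 <= p := omega_ge0 a.
(* As b is null, the square is affine in the coefficient; this choice makes its value -(p + 2),
   contradicting positivity. *)
have := omega_ge0 (a - ((p + 1) / (g * g^*%R) * g^*%R) *: b).
rewrite state_square_sub b0 mulr0 addr0 -/g -/p gC !rmorphM /= conjCK.
rewrite fmorphV rmorphM /= rmorphD /= conjCK rmorph1 (conj_Creal (ger0_real p0)).
have -> : p - (p + 1) / (g * g^*%R) * g^*%R * g -
    (p + 1) / (g^*%R * g) * g * g^*%R = - (p + 2).
  have gc0 : g^*%R != 0 by rewrite conjC_eq0.
  by field; rewrite g0 gc0.
by rewrite oppr_ge0 => /(lt_le_trans _) - /(_ 0); rewrite ltxx ltr_wpDl // => /(_ isT).
Qed.

(** The element a* a / (2 ||a||^2) has norm 1/2, so 1 minus it is a square y* y and omega(a* a) <= 2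
    ||a||^2. Cauchy-Schwarz against 1 gives |omega(a)|^2 <= omega(a* a). The constant is not sharp,
    but continuity is all that is wanted. *)
Lemma state_norm_le a : Normc.normc (omega a) <= 2 * cnorm a.
Proof.
have le1 : omega (star a * a) <= (2 * cnorm a ^+ 2)%:C.
  have [a0|a0] := eqVneq (cnorm a) 0.
    by rewrite (cnorm_eq0 _ a0) mulr0 linear0 cnorm0 expr0n mulr0.
  have apos : 0 < 2 * cnorm a ^+ 2 by rewrite mulr_gt0 // exprn_even_gt0.
  have [||y ysa ey] := @sqrt_one_sub R A ((2 * cnorm a ^+ 2)^-1%:C *: (star a * a)).
  - by rewrite starZ starM starK conjC_real_complex.
  - rewrite cnormZreal cnorm_starM gtr0_norm ?invr_gt0 // invfM mulfVK //.
    by rewrite expf_eq0.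
  have := omega_ge0 y; rewrite ysa -ey linearB linearZ /= omega1 subr_ge0.
  by rewrite fmorphV /= mulrC ler_pdivrMr ?mul1r // ltcR.
have le2 : `|omega a| ^+ 2 <= omega (star a * a).
  have := omega_ge0 (a - omega a *: 1).
  rewrite state_square_sub star1 !mulr1 mul1r omega1 state_star normCK mulr1.
  by rewrite [_ * omega a]mulrC subrK subr_ge0.
have := le_trans le2 le1; rewrite -rmorphXn lecR /= -/(Normc.normc _) => le3.
rewrite -(@ler_pXn2r _ 2) ?nnegrE ?mulr_ge0 ?cnorm_ge0 //; last first.
  by case: (omega a) => ? ?; exact: sqrtr_ge0.
rewrite exprMn (le_trans le3) // ler_wpM2r ?sqr_ge0 // expr2.
lra.
Qed.

(* Boundedness lets an identity pass from a dense set to the whole algebra. *)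
Lemma state_closed_zero x y : norm_closed [set a : A | omega (x * a * y) = 0]%classic.
Proof.
move=> a clos /=; apply: Normc.eq0_normc.
set r := Normc.normc _; have r_le e : 0 < e -> r <= 2 * (cnorm x * e * cnorm y).
  move=> /clos[b /= b0 ltb].
  have -> : r = Normc.normc (omega (x * (a - b) * y)).
    by rewrite /r mulrBr mulrBl linearB /= b0 subr0.
  apply: le_trans (state_norm_le _) _; rewrite ler_pM2l //.
  apply: le_trans (cnormM _ _) _; rewrite ler_wpM2r ?cnorm_ge0 //.
  apply: le_trans (cnormM _ _) _; rewrite ler_wpM2l ?cnorm_ge0 //.
  by rewrite cnorm_distC ltW.
have r0 : 0 <= r by rewrite /r; case: (omega _) => ? ?; exact: sqrtr_ge0.
apply/eqP; rewrite eq_le r0 andbT leNgt; apply/negP => rpos.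
(* Taking e = r / (2(K + 1)) yields r <= r K / (K + 1) < r; the added 1 also covers K = 0. *)
set K := cnorm x * cnorm y; have K0 : 0 <= K by rewrite mulr_ge0 ?cnorm_ge0.
have K1 : 0 < 2 * (K + 1) by rewrite mulr_gt0 // ltr_wpDl.
have := r_le (r / (2 * (K + 1))) (divr_gt0 rpos K1).
have -> : 2 * (cnorm x * (r / (2 * (K + 1))) * cnorm y) = r * (K / (K + 1)).
  by rewrite /K; field; rewrite -/K; lra.
by rewrite ler_pMr // ler_pdivlMr ?ltr_wpDl // mul1r; lra.
Qed.

End State.

(** * Density of the span of the products s_I s_J^* *)

Lemma closure_cstar_subalgebra (R : realType) (A : cstarAlgType R) (S : A -> Prop) :
  S 1 -> (forall (c : R[i]) a b, S a -> S b -> S (c *: a + b)) ->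
  (forall a b, S a -> S b -> S (a * b)) -> (forall a, S a -> S (star a)) ->
  cstar_subalgebra
    [set a : A | forall e : R, 0 < e -> exists2 b, S b & cnorm (b - a) < e]%classic.
Proof.
move=> S1 SL SM Sstar; split => [e e0|c a b Sa Sb e e0|a b Sa Sb e e0|a Sa e e0|a Sa e e0] /=.
- by exists 1; rewrite // subrr cnorm0.
- set r := Normc.normc c.
  have r0 : 0 <= r by rewrite /r; case: (c) => ? ?; exact: sqrtr_ge0.
  have d0 : 0 < e / (2 * (r + 1)) by rewrite divr_gt0 // mulr_gt0 // ltr_wpDl.
  have [a' Sa' da] := Sa _ d0; have [b' Sb' db] := Sb _ d0.
  exists (c *: a' + b'); first exact: SL.
  have -> : c *: a' + b' - (c *: a + b) = c *: (a' - a) + (b' - b).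
    by rewrite scalerBr opprD addrACA.
  apply: le_lt_trans (cnormD _ _) _; rewrite cnormZ -/r.
  have -> : e = r * (e / (2 * (r + 1))) + e / (2 * (r + 1)) + e / 2.
    by field; lra.
  have := ler_wpM2l r0 (ltW da); lra.
- set M := cnorm a + cnorm b + 1.
  have M0 : 0 < M by rewrite /M ltr_wpDl // addr_ge0 ?cnorm_ge0.
  (* The cap 1 bounds the norm of the approximant [a'] by [cnorm a + 1]. *)
  have d0 : 0 < Num.min 1 (e / (2 * M)) :> R.
    by rewrite lt_min ltr01 divr_gt0 // mulr_gt0.
  have [a' Sa'] := Sa _ d0; rewrite lt_min => /andP[a1 da].
  have [b' Sb'] := Sb _ d0; rewrite lt_min => /andP[_ db].
  exists (a' * b'); first exact: SM.
  have -> : a' * b' - a * b = a' * (b' - b) + (a' - a) * b.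
    by rewrite mulrBr mulrBl addrA subrK.
  apply: le_lt_trans (cnormD _ _) _.
  have a'le : cnorm a' <= cnorm a + 1.
    have -> : a' = a + (a' - a) by rewrite addrC subrK.
    by apply: le_trans (cnormD _ _) _; lra.
  have h1 := le_trans (cnormM a' (b' - b))
    (ler_pM (cnorm_ge0 _) (cnorm_ge0 _) a'le (ltW db)).
  have h2 := le_trans (cnormM (a' - a) b) (ler_wpM2r (cnorm_ge0 b) (ltW da)).
  have : (cnorm a + 1) * (e / (2 * M)) + e / (2 * M) * cnorm b = e / 2.
    by rewrite /M; field; rewrite -/M; lra.
  lra.
- have [b Sb db] := Sa e e0; exists (star b); first exact: Sstar.
  by rewrite -starN -starD cnorm_star.
- have e2 : 0 < e / 2 by rewrite divr_gt0.
  have [b Sb db] := Sa _ e2; have [b' Sb' db'] := Sb _ e2.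
  exists b' => //; rewrite -(subrKA b).
  by apply: le_lt_trans (cnormD _ _) _; lra.
Qed.

Section Words.
Variables (R : realType) (n : nat) (A : cstarAlgType R) (s : 'I_n -> A).

Definition word (I : seq 'I_n) : A := \prod_(i <- I) s i.

(** The linear span, built one term at a time so that linear statements reduce to a single product
    s_I s_J^* by induction. *)
Inductive word_span : A -> Prop :=
| word_span0 : word_span 0
| word_spanD (c : R[i]) (I J : seq 'I_n) (a : A) : word_span a ->
    word_span (c *: (word I * star (word J)) + a).

Lemma word_nil : word [::] = 1.
Proof. exact: big_nil. Qed.

Lemma word_cons i I : word (i :: I) = s i * word I.
Proof. exact: big_cons. Qed.

Lemma word_rcons I i : word (rcons I i) = word I * s i.
Proof. by rewrite /word -cats1 big_cat big_seq1. Qed.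

Lemma word_span_word I J : word_span (word I * star (word J)).
Proof. by rewrite -[_ * _]addr0 -[_ * _]scale1r; do 2 constructor. Qed.

Lemma word_span_linear c a b : word_span a -> word_span b -> word_span (c *: a + b).
Proof.
move=> + sb; elim=> [|d I J {}a _ IH]; first by rewrite scaler0 add0r.
by rewrite scalerDr scalerA -addrA; constructor.
Qed.

Lemma word_span_star a : word_span a -> word_span (star a).
Proof.
elim=> [|c I J {}a _ IH]; first by rewrite star0; constructor.
by rewrite starD starZ starM starK; constructor.
Qed.

Hypothesis s_cuntz : cuntz_family s.

Lemma word_span_mulgen i a : word_span a -> word_span (s i * a).
Proof.
elim=> [|c I J {}a _ IH]; first by rewrite mulr0; constructor.
by rewrite mulrDr -scalerAr mulrA -word_cons; constructor.
Qed.

(** If I is nonempty, s_i^* meets its first letter and gives 0 or 1; if I is empty, s_i^* is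
    absorbed as a new last letter of J. *)
Lemma word_span_mulstar i a : word_span a -> word_span (star (s i) * a).
Proof.
elim=> [|c I J {}a _ IH]; first by rewrite mulr0; constructor.
rewrite mulrDr -scalerAr; apply: word_span_linear => //.
case: I => [|p I].
  rewrite word_nil mul1r -starM -word_rcons.
  by rewrite -[star _]mul1r -word_nil; exact: word_span_word.
rewrite word_cons !mulrA s_cuntz.1 -mulrA.
case: (_ == _); first by rewrite mul1r; exact: word_span_word.
by rewrite mul0r; constructor.
Qed.

Lemma word_spanM a b : word_span a -> word_span b -> word_span (a * b).
Proof.
move=> sa sb; elim: sa => [|c I J {}a _ IH]; first by rewrite mul0r; constructor.
rewrite mulrDl -scalerAl; apply: word_span_linear => //; rewrite -mulrA.
elim: I => [|i I IHI].
  rewrite word_nil mul1r.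
  elim/last_ind: J => [|J i IHJ]; first by rewrite word_nil star1 mul1r.
  by rewrite word_rcons starM -mulrA; exact: word_span_mulstar.
by rewrite word_cons -mulrA; exact: word_span_mulgen.
Qed.

Lemma word_span_dense (S : set A) : cstar_generated s -> norm_closed S ->
  (forall a, word_span a -> S a) -> forall a, S a.
Proof.
move=> gen Scl Sspan a; apply: Scl => e e0.
have word_span1 : word_span 1.
  by have := word_span_word [::] [::]; rewrite word_nil star1 mulr1.
have clS := closure_cstar_subalgebra word_span1 word_span_linear word_spanM
  word_span_star.
have gens i d : 0 < d -> exists2 b, word_span b & cnorm (b - s i) < d.
  move=> d0; exists (s i); last by rewrite subrr cnorm0.
  by rewrite -[s i]mulr1; exact: word_span_mulgen.
have : [set: A]%classic a by [].
rewrite -(gen _ clS gens) => /(_ e e0)[b /Sspan Sb ltb].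
by exists b.
Qed.

End Words.

(** * Eigenvectors of the last generator in the GNS space, with <a, b> = omega(a* b) *)

Section Eigenvectors.
Variables (R : realType) (n : nat) (hn : (2 <= n)%N) (A : cstarAlgType R).
Variables (s : 'I_n -> A) (omega : {scalar A}).
Hypotheses (s_cuntz : cuntz_family s) (s_gen : cstar_generated s).
Hypothesis omega_state : is_state omega.
Local Notation last := (last_ord hn).

(* In the GNS representation, [e] applied to the cyclic vector is an
   eigenvector (possibly zero) of the last generator with eigenvalue [w]. *)
Definition eigen (w : R[i]) (e : A) : Prop :=
  forall x : A, omega (x * s last * e) = w * omega (x * e).

(** Apply the eigenvector equation with x s_l^* in place of x, and use s_l^* s_n = 0 or 1. *)
Lemma eigen_star w e (l : 'I_n) x : w != 0 -> eigen w e ->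
  omega (x * star (s l) * e) = (l == last)%:R / w * omega (x * e).
Proof.
move=> w0 /(_ (x * star (s l))) eig; apply: (mulfI w0); rewrite -eig.
rewrite -[_ * s last]mulrA s_cuntz.1 mulrA mulrCA divff // mulr1.
by case: (_ == _); rewrite ?mulr1 ?mulr0 ?mul0r ?mul1r ?linear0.
Qed.

Lemma eigen_word w e J : w != 0 -> eigen w e ->
  exists d, forall x, omega (x * star (word s J) * e) = d * omega (x * e).
Proof.
move=> w0 eig; elim: J => [|i J [d IH]].
  by exists 1 => x; rewrite word_nil star1 mulr1 mul1r.
exists ((i == last)%:R / w * d) => x.
by rewrite word_cons starM mulrA (eigen_star _ _ w0 eig) IH mulrA.
Qed.

(** The isometry s_n preserves inner products: <e1, e2> = <s_n e1, s_n e2> = conj(w1) w2 <e1,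
    e2>. *)
Lemma eigen_orthogonal w1 w2 e1 e2 : w1^*%R * w2 != 1 ->
  eigen w1 e1 -> eigen w2 e2 -> omega (star e1 * e2) = 0.
Proof.
move=> w12 eig1 eig2; apply/eqP.
have eq12 : omega (star e1 * e2) = w1^*%R * w2 * omega (star e1 * e2).
  rewrite -mulrA [w2 * _]mulrC mulrA [_ * w2]mulrC.
  have -> : w1^*%R * omega (star e1 * e2) = omega (star e1 * star (s last) * e2).
    have := congr1 Num.conj (eig1 (star e2)).
    by rewrite rmorphM /= -!state_star // !starM starK mulrA => ->.
  rewrite -eig2 -[_ * s last]mulrA s_cuntz.1 eqxx mulr1 //.
have : (1 - w1^*%R * w2) * omega (star e1 * e2) = 0.
  by rewrite mulrBl mul1r -eq12 subrr.
by move=> /eqP; rewrite mulf_eq0 subr_eq0 eq_sym (negbTE w12).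
Qed.

(** In <e1, s_I s_J^* e2> the factor s_J^* acts on e2 by a scalar, and so does s_I^* on e1, leaving
    a multiple of <e1, e2> = 0. Density and continuity extend this to all a. *)
Lemma eigen_disjoint w1 w2 e1 e2 a : w1 != 0 -> w2 != 0 -> w1^*%R * w2 != 1 ->
  eigen w1 e1 -> eigen w2 e2 -> omega (star e1 * a * e2) = 0.
Proof.
move=> w10 w20 w12 eig1 eig2; move: a.
apply: (word_span_dense s_cuntz s_gen (@state_closed_zero R A omega omega_state _ _)).
move=> a /=; elim=> [|c I J {}a _ IH]; first by rewrite mulr0 mul0r linear0.
rewrite mulrDr mulrDl linearD /= IH addr0 -scalerAr -scalerAl linearZ /=.
have [d2 Hd2] := eigen_word J w20 eig2; have [d1 Hd1] := eigen_word I w10 eig1.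
have -> : omega (star e1 * (word s I * star (word s J)) * e2) =
    d2 * (d1 * omega (star e2 * e1))^*%R.
  rewrite -Hd1 -state_star // !starM !starK !mulrA; exact: Hd2.
rewrite rmorphM /= -state_star // starM starK.
by rewrite (eigen_orthogonal w12 eig1 eig2) !mulr0.
Qed.

End Eigenvectors.

(** * Vector states and Cuntz states *)

Section VectorState.
Variables (R : realType) (A : cstarAlgType R) (omega : {scalar A}) (e : A).

(** For a null e, division by zero gives the zero functional; linearity thus holds for every e. *)
Definition vector_functional (a : A) : R[i] :=
  omega (star e * a * e) / omega (star e * e).

Fact vector_functional_is_linear : linear_for *%R vector_functional.
Proof.
move=> c a b; rewrite /vector_functional mulrDr mulrDl -scalerAr -scalerAl.
by rewrite linearP /= mulrDl mulrA.
Qed.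

HB.instance Definition _ :=
  GRing.isLinear.Build R[i] A R[i] *%R vector_functional vector_functional_is_linear.

Lemma vector_functional_state : is_state omega -> omega (star e * e) != 0 ->
  is_state vector_functional.
Proof.
move=> [pos _] e0; split=> [a|]; last by rewrite -[LHS]/(_ / _) mulr1 divff.
rewrite -[X in _ <= X]/(_ / _) divr_ge0 ?pos //.
by rewrite mulrA -mulrA -starM; exact: pos.
Qed.

End VectorState.

Section CuntzStates.
Variables (R : realType) (n : nat) (hn : (2 <= n)%N) (A : cstarAlgType R).
Variables (s : 'I_n -> A).
Local Notation last := (last_ord hn).

Lemma unit_last_coord_vec (u : R[i]) : `|u| = 1 -> unit_vector (last_coord_vec hn u).
Proof.
move=> u1; rewrite /unit_vector (bigD1 last) //= mxE eqxx u1 expr1n.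
by rewrite big1 ?addr0 // => i /negbTE il; rewrite mxE il normr0 expr0n.
Qed.

Lemma eigen_cuntz_state (omega : {scalar A}) (u : R[i]) (e : A) :
  cuntz_family s -> is_state omega -> `|u| = 1 ->
  eigen hn s omega u^*%R e -> omega (star e * e) != 0 ->
  cuntz_state s (last_coord_vec hn u) (vector_functional omega e).
Proof.
move=> s_cuntz st u1 eig e0; split; first exact: unit_last_coord_vec.
  exact: vector_functional_state.
have u0 : u^*%R != 0 by rewrite conjC_eq0 -normr_eq0 u1 oner_eq0.
move=> j; rewrite mxE /= /vector_functional; case: eqVneq => [->|jl].
  by rewrite eig mulfK.
rewrite conjC0; apply/eqP; rewrite mulf_eq0 -conjC_eq0 -state_star //.
by rewrite !starM starK mulrA (eigen_star s_cuntz _ _ u0 eig) (negbTE jl) !mul0r eqxx.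
Qed.

(* Precompose with the gauge endomorphism that rescales the last generator. *)
Lemma cuntz_state_rotate (u v : R[i]) (rho : {scalar A}) :
  is_cuntz_algebra s -> `|u| = 1 -> `|v| = 1 ->
  cuntz_state s (last_coord_vec hn u) rho ->
  exists rho' : {scalar A}, cuntz_state s (last_coord_vec hn v) rho'.
Proof.
move=> [[s_orth s_sum] _ univ] u1 v1 [_ [pos rho1] rhos].
have normJ (x : R[i]) : `|x| = 1 -> x * x^*%R = 1 by rewrite -normCK => ->; rewrite expr1n.
(* The factor is chosen so that s_n goes to u conj(v) s_n, on which [rho] takes the value u conj(v)
   conj(u) = conj(v). *)
pose c i : R[i] := if i == last then u * v^*%R else 1.
have cJ i : c i * (c i)^*%R = 1.
  apply: normJ; rewrite /c; case: ifP => _; rewrite ?normr1 //.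
  by rewrite normrM norm_conjC u1 v1 mulr1.
have [|phi [phi_star phis]] := univ A (fun i => c i *: s i).
  split=> [i j|].
    rewrite starZ -scalerAl -scalerAr s_orth scalerA.
    case: eqVneq => [->|_]; last by rewrite scaler0.
    by rewrite mulrC cJ scale1r.
  rewrite -s_sum; apply: eq_bigr => i _.
  by rewrite starZ -scalerAl -scalerAr scalerA cJ scale1r.
exists (rho \o phi); split; first exact: unit_last_coord_vec.
  split=> [a|] /=; last by rewrite rmorph1.
  by rewrite rmorphM /= phi_star; exact: pos.
move=> j /=; rewrite phis linearZ /= rhos !mxE /c.
case: eqVneq => [_|_]; last by rewrite mul1r.
by rewrite mulrAC normJ // mul1r.
Qed.

End CuntzStates.

(** * Roots of unity and their power sums *)

Section Roots.
Variable R : realType.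

Lemma expiD (a b : R) : expi (a + b) = expi a * expi b.
Proof. by rewrite /expi cosD sinD; simpc; rewrite [sin a * _ + _]addrC. Qed.

Lemma expiX (a : R) m : expi (a * m%:R) = expi a ^+ m.
Proof.
elim: m => [|m IH]; first by rewrite mulr0 /expi cos0 sin0.
by rewrite exprS -IH -expiD mulrSr mulrDr mulr1 addrC.
Qed.

(** If cos t = 1, the double-angle formula forces cos(t/2)^2 = 1, whereas sin(t/2) > 0 on this
    range. *)
Lemma expi_neq1 (t : R) : 0 < t < 2 * pi -> expi t != 1.
Proof.
move=> /andP[t0 t2]; apply/negP => /eqP[cos1 _].
have s0 : 0 < sin (t / 2).
  by apply: sin_gt0_pi; rewrite divr_gt0 //= ltr_pdivrMr // mulrC.
have : cos (t / 2) ^+ 2 = 1.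
  have t2E : t / 2 *+ 2 = t by rewrite -mulr_natr divfK ?pnatr_eq0.
  have := cos_mulr2n (t / 2); rewrite t2E cos1.
  rewrite -mulr_natr; lra.
by move: (cos2Dsin2 (t / 2)) => /[swap] ->; have := exprn_gt0 2 s0; lra.
Qed.

Lemma prim_root_expi k : (0 < k)%N -> k.-primitive_root (expi (2 * pi / k%:R : R)).
Proof.
move=> k0; have kR : (0 : R) < k%:R by rewrite ltr0n.
rewrite /primitive_root_of_unity k0; apply/forallP => i; rewrite unity_rootE -expiX.
apply/eqP; have [->|ik] := eqVneq i.+1 k.
  rewrite divfK ?lt0r_neq0 // /expi mulrC mulr_natr -[pi *+ 2]add0r cosD2pi sinD2pi.
  by rewrite cos0 sin0 eqxx.
have ltik : (i.+1 < k)%N by rewrite ltn_neqAle ik ltn_ord.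
apply/negbTE/expi_neq1; rewrite mulrAC.
have pp := pi_gt0 R.
rewrite divr_gt0 ?mulr_gt0 ?ltr0n //= ltr_pdivrMr // ltr_pM2l ?mulr_gt0 //.
by rewrite ltr_nat.
Qed.

End Roots.

Lemma sum_prim_root_expr (F : fieldType) k (x : F) l : k.-primitive_root x ->
  (l < k)%N -> \sum_(j < k) (x ^+ j.+1) ^+ l = (l == 0)%:R * k%:R.
Proof.
move=> prim lk; have [->|l0] := eqVneq l 0.
  by under eq_bigr do rewrite expr0; rewrite sumr_const card_ord mul1r.
rewrite mul0r; under eq_bigr do rewrite -exprM mulnC exprM exprS.
rewrite -mulr_sumr; apply/eqP; rewrite mulf_eq0; apply/orP; right.
have xl1 : x ^+ l - 1 != 0.
  by rewrite subr_eq0 -(prim_order_dvd prim) gtnNdvd // lt0n.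
(* Multiplying by the nonzero x^l - 1 telescopes the geometric sum to x^(lk) - 1 = 0. *)
rewrite -(mulrI_eq0 _ (mulfI xl1)) -subrX1.
by rewrite -exprM mulnC exprM (prim_expr_order prim) expr1n subrr.
Qed.

(** * Spectral decomposition of the cyclic vector *)

Lemma norm_root1 (C : numDomainType) (x : C) m : (0 < m)%N -> `|x ^+ m| = 1 -> `|x| = 1.
Proof. by move=> m0; rewrite normrX => /eqP; rewrite pexprn_eq1 // (gtn_eqF m0) => /eqP. Qed.

(** Equality in Cauchy-Schwarz: v - omega(v) 1 is null, its square having value 1 - |omega(v)|^2 =
    0. *)
Lemma state_isometry (R : realType) (A : cstarAlgType R) (omega : {scalar A})
    (v : A) : is_state omega -> star v * v = 1 -> `|omega v| = 1 ->
  forall x, omega (x * v) = omega v * omega x.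
Proof.
move=> st vv v1 x.
have : omega (x * (v - omega v *: 1)) = 0.
  apply: state_null => //.
  rewrite state_square_sub // star1 !mulr1 mul1r vv state_star // st.2.
  by rewrite [_^*%R * _]mulrC -normCK v1 expr1n; ring.
by rewrite mulrBr linearB -scalerAr mulr1 linearZ /= => /eqP; rewrite subr_eq0 => /eqP.
Qed.

Lemma star_isometryX (R : realType) (A : cstarAlgType R) (v : A) m :
  star v * v = 1 -> star (v ^+ m) * v ^+ m = 1.
Proof.
move=> vv; elim: m => [|m IH]; first by rewrite expr0 star1 mulr1.
by rewrite {1}exprS starM exprS mulrA -[_ * v]mulrA vv mulr1.
Qed.

Theorem theorem1p6 (R : realType) (n k : nat) (hn : (2 <= n)%N) (hk : (2 <= k)%N)
    (A : cstarAlgType R) (s : 'I_n -> A) (hA : is_cuntz_algebra s)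
    (z : 'rV[R[i]]_(n.-1 * k).+1) (hz : unit_vector z)
    (hzm : `|z 0 ord_max| = 1)
    (q : R[i]) (hq : q ^+ k = z 0 ord_max)
    (omega : {scalar A}) (homega : geometric_progression_state hn s z omega) :
  exists (lambda : 'I_k -> R) (rho : 'I_k -> {scalar A}),
    [/\ forall j : 'I_k, 0 <= lambda j,
        \sum_(j < k) lambda j = 1,
        forall j : 'I_k,
          cuntz_state s
            (last_coord_vec hn (expi (2 * pi * j.+1%:R / k%:R) * q)) (rho j) &
        forall a : A, omega a = \sum_(j < k) (lambda j)%:C * rho j a].
Proof.
have [s_cuntz s_gen _] := hA; have [_ st _ omega_sk] := homega.
have k0 : (0 < k)%N := ltnW hk.
pose s0 := s (last_ord hn).
pose zeta : R[i] := expi (2 * pi / k%:R).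
have prim : k.-primitive_root zeta := prim_root_expi R k0.
pose u (j : 'I_k) : R[i] := expi (2 * pi * j.+1%:R / k%:R) * q.
have uE j : u j = zeta ^+ j.+1 * q by rewrite /u mulrAC expiX.
have uX j : u j ^+ k = z 0 ord_max.
  by rewrite uE exprMn hq -exprM mulnC exprM (prim_expr_order prim) expr1n mul1r.
have u1 j : `|u j| = 1 by apply: (norm_root1 k0); rewrite uX.
have uJ j : u j * (u j)^*%R = 1 by rewrite -normCK u1 expr1n.
have uJ0 j : (u j)^*%R != 0 by rewrite conjC_eq0 -normr_eq0 u1 oner_eq0.
have q0 : q != 0 by rewrite -normr_eq0 (norm_root1 k0) ?hq // oner_eq0.
have zeta0 : zeta != 0.
  by rewrite -normr_eq0 (norm_root1 k0) ?(prim_expr_order prim) ?normr1 ?oner_eq0.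
(* On the unit circle u_i conj(u_j) = 1 means u_i = u_j. The double conjugate matches
   [eigen_disjoint] for eigenvalues conj(u_j); the exponents 1, ..., k are lowered by one before
   being compared modulo k. *)
have u_inj i j : i != j -> (u i)^*%R^*%R * (u j)^*%R != 1.
  apply: contraNneq; rewrite conjCK => /(congr1 (fun x => x * u j)).
  rewrite mul1r -mulrA [_ * u j]mulrC uJ mulr1 !uE => /(mulIf q0) /eqP.
  rewrite !exprS (inj_eq (mulfI _)) //.
  rewrite (eq_prim_root_expr prim) !modn_small //.
(* A polynomial in s_n that acts on the cyclic vector, where s_n^k is the scalar conj(z_m), as the
   projection to the eigenvalue conj(u_j). *)
pose P j : A := (k%:R : R[i])^-1 *: \sum_(l < k) (u j *: s0) ^+ l.
have eigP j : eigen hn s omega (u j)^*%R (P j).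
  move=> x; apply: (mulfI (_ : u j != 0)); first by rewrite -conjC_eq0.
  rewrite [RHS]mulrA uJ mul1r; apply/eqP; rewrite -subr_eq0.
  (* Telescoping gives (u_j s_n - 1) P_j = ((u_j s_n)^k - 1) / k, which kills the cyclic vector
     since z_m conj(z_m) = 1. *)
  have -> : u j * omega (x * s0 * P j) - omega (x * P j) =
      k%:R^-1 * omega (x * ((u j *: s0) ^+ k - 1)).
    rewrite subrX1 /P -!scalerAr !scalarZ; move: (\sum_(l < k) _) => S.
    have -> : x * ((u j *: s0 - 1) * S) = u j *: (x * s0 * S) - x * S.
      by rewrite mulrBl mul1r mulrBr -scalerAl -scalerAr mulrA.
    by rewrite linearB scalarZ; ring.
  rewrite exprZn uX mulrBr mulr1 -scalerAr linearB linearZ /=.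
  rewrite (state_isometry st (star_isometryX _ _)) ?s_cuntz.1 ?eqxx // omega_sk ?norm_conjC //.
  by rewrite mulrA -normCK hzm expr1n mul1r subrr mulr0.
(* An identity in the algebra itself: the power sums of the u_j vanish for 0 < l < k, so only the
   term l = 0 survives. *)
have sumP : \sum_j P j = 1.
  rewrite -scaler_sumr exchange_big /=.
  under eq_bigr => l _ do under eq_bigr => j _ do rewrite uE exprZn exprMn -scalerA.
  under eq_bigr => l _ do rewrite -scaler_suml (sum_prim_root_expr prim) //.
  rewrite (bigD1 (Ordinal k0)) //= !expr0 mul1r scale1r big1 ?addr0.
    by rewrite scalerA mulVf ?scale1r // pnatr_eq0 -lt0n.
  by move=> l l0; rewrite -[_ == 0]/(l == Ordinal k0) (negbTE l0) mul0r scale0r.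
(* Insert 1 = sum_j P_j on both sides of a; the cross terms vanish by [eigen_disjoint]. *)
have omegaE a : omega a = \sum_j omega (star (P j) * a * P j).
  rewrite -[a in LHS]mulr1 -[a in LHS]mul1r -{1}star1 -sumP star_sum mulr_suml mulr_suml linear_sum /=.
  apply: eq_bigr => i _; rewrite mulr_sumr linear_sum /= (bigD1 i) //= big1 ?addr0 //.
  move=> j ji; apply: (eigen_disjoint s_cuntz s_gen st _ (uJ0 i) (uJ0 j) _ (eigP i) (eigP j)).
  by rewrite u_inj // eq_sym.
pose c j := omega (star (P j) * P j).
have c_ge0 j : 0 <= c j := st.1 (P j).
have sumc : \sum_j c j = 1.
  by rewrite -st.2 omegaE; apply: eq_bigr => j _; rewrite mulr1.
have cE j : (complex.Re (c j))%:C = c j by rewrite RRe_real // ger0_real.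
have cuntzP j : c j != 0 ->
    cuntz_state s (last_coord_vec hn (u j)) (vector_functional omega (P j)).
  exact: eigen_cuntz_state.
have [j0 cj0] : exists j0, c j0 != 0.
  apply/existsP; rewrite -negb_forall; apply/negP => /forallP call.
  have := sumc; rewrite big1 => [/esym/eqP|j _]; first by rewrite oner_eq0.
  by have := call j => /eqP.
have rhoP j : exists rho : {scalar A}, cuntz_state s (last_coord_vec hn (u j)) rho /\
    forall a, omega (star (P j) * a * P j) = c j * rho a.
  have [cj|cj] := eqVneq (c j) 0; last first.
    exists (vector_functional omega (P j)); split; first exact: cuntzP.
    by move=> a; rewrite mulrCA divff // mulr1.
  (* The weight is 0 here, yet a genuine Cuntz state must be supplied; it is rotated from the index
     [j0] of nonzero weight. *)
  have [rho rhoC] := cuntz_state_rotate hA (u1 j0) (u1 j) (cuntzP _ cj0).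
  by exists rho; split=> // a; rewrite cj mul0r state_null.
have [rho rhoE] := boolp.choice rhoP.
exists (fun j => complex.Re (c j)), rho; split=> [j||j|a].
- by rewrite -lecR cE.
- by apply: (@complexI R); rewrite rmorph_sum /= -[RHS]sumc; apply: eq_bigr.
- by have [] := rhoE j.
- by rewrite omegaE; apply: eq_bigr => j _; rewrite cE; have [_ ->] := rhoE j.
Qed.
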